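(* Let $N\ge0$ be an integer and let $a,b$ be real parameters that are generic, i.e. such that no denominator below vanishes. For all $m,n\in\{0,\dots,N\}$ the rational function $\mathcal V_m(n;a,b,N)$ of Hahn type satisfies the recurrence relation $$(N-n-m-b+a-2)\,\mathcal A_m\big(\mathcal V_{m+1}(n;a,b,N)-\mathcal V_m(n;a,b,N)\big)+(-n+m+a-2)\,\mathcal C_m\big(\mathcal V_{m-1}(n;a,b,N)-\mathcal V_m(n;a,b,N)\big)$$ $$=(b-a+2)(2m+b-N)\,\mathcal V_m(n;a,b,N),$$ where $$\mathcal A_m=\frac{(m+b+1)(m+b-N)}{2m+b-N+1},\qquad \mathcal C_m=\frac{m(m-N-1)}{2m+b-N-1}.$$
   Context: Rational functions of Hahn type: for $m=0,\dots,N$, $$\mathcal U_m(x;a,b,N)=\frac{(-1)^m(-N)_m}{(b+1)_m}\sum_{\ell=0}^m\frac{(-x)_\ell(-m)_\ell(b+m-N)_\ell}{\ell!\,(-N)_\ell(a-x)_\ell},\qquad \mathcal V_m(x;a,b,N)=\mathcal U_m(N-x;b+2-a,b,N)$$ (the sum is ${}_3F_2(-x,-m,b+m-N;-N,a-x;1)$), where $(x)_0=1$, $(x)_k=x(x+1)\cdots(x+k-1)$. Conventions at the ends: $\mathcal V_{N+1}(n;a,b,N)=0$ for $n=0,\dots,N$ (consistent with the prefactor $(-N)_{N+1}=0$), and the term with $\mathcal C_0=0$ is omitted for $m=0$. *)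

(* Defs.v *)
From mathcomp Require Import all_boot all_order all_algebra.
From mathcomp Require Import reals.

Set Implicit Arguments.
Unset Strict Implicit.
Unset Printing Implicit Defensive.

Import Order.TTheory GRing.Theory Num.Theory.
Local Open Scope ring_scope.

Definition poch (R : realType) (x : R) (k : nat) : R :=
  \prod_(i < k) (x + i%:R).

(* The sum is the terminating 3F2(-x, -m, b+m-N; -N, a-x; 1).  It is meant for
   m <= N only: beyond that (-N)_l vanishes in a denominator. *)
Definition hahnU (R : realType) (m : nat) (x a b : R) (N : nat) : R :=
  (-1) ^+ m * poch (- N%:R) m / poch (b + 1) m *
  \sum_(l < m.+1)
     (poch (- x) l * poch (- m%:R) l * poch (b + m%:R - N%:R) l) /
     (l`!%:R * poch (- N%:R) l * poch (a - x) l).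

(* The index N+1 occurs in the recurrence at m = N, where the convention is
   that V_(N+1) vanishes. *)
Definition hahnV (R : realType) (m : nat) (x a b : R) (N : nat) : R :=
  if (m <= N)%N then hahnU m (N%:R - x) (b + 2 - a) b N else 0.

Definition hahnA (R : realType) (m : nat) (b : R) (N : nat) : R :=
  ((m%:R + b + 1) * (m%:R + b - N%:R)) / (2 * m%:R + b - N%:R + 1).

Definition hahnC (R : realType) (m : nat) (b : R) (N : nat) : R :=
  (m%:R * (m%:R - N%:R - 1)) / (2 * m%:R + b - N%:R - 1).

(* No denominator vanishes in V_m(n), A_m (0 <= m, n <= N) and C_m
   (1 <= m <= N; the C_0 term is omitted).  The factors l! and (-N)_l with
   l <= N are never zero, so they impose no condition on a and b. *)
Definition generic (R : realType) (a b : R) (N : nat) : Prop :=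
  [/\ forall m : nat, (m <= N)%N -> poch (b + 1) m != 0,
      forall n l : nat, (n <= N)%N -> (l <= N)%N ->
        poch (b + 2 - a - (N%:R - n%:R)) l != 0,
      forall m : nat, (m <= N)%N -> 2 * m%:R + b - N%:R + 1 != 0
    & forall m : nat, (1 <= m <= N)%N -> 2 * m%:R + b - N%:R - 1 != 0].

(* Main.v *)
Require Import Defs.
From mathcomp Require Import all_boot all_order all_algebra.
From mathcomp Require Import reals.
From mathcomp Require Import ring.

Import Order.TTheory GRing.Theory Num.Theory.
Local Open Scope ring_scope.

(** Put [x = N - n] and [alpha = b + 2 - a], and write [V_m(n)] as a prefactor
    times [\sum_l hahn_coef m l * hahn_weight l], where only [hahn_coef] depends
    on [m].  After clearing the prefactors, the [l]-th term of the recurrence is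
    a difference [K_l - K_(l-1)] with
    [K_l = (2m + b - N) (l - x) hahn_coef m l * hahn_weight l],
    so the sum telescopes to [K_N], which contains the factor
    [(-x)_(N+1) = 0]. *)

Lemma poch0 (R : realType) (x : R) : poch x 0 = 1.
Proof. by rewrite /poch big_ord0. Qed.

Lemma pochSr (R : realType) (x : R) (k : nat) :
  poch x k.+1 = poch x k * (x + k%:R).
Proof. by rewrite /poch big_ord_recr. Qed.

Lemma pochSl (R : realType) (x : R) (k : nat) :
  poch x k.+1 = x * poch (x + 1) k.
Proof.
rewrite /poch big_ord_recl addr0; congr (_ * _).
by apply: eq_bigr => i _; rewrite /= /bump /= natrD addrA.
Qed.

Lemma poch_oppn_eq0 (R : realType) (m k : nat) :
  (poch (- m%:R : R) k == 0) = (m < k)%N.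
Proof.
apply/prodf_eq0/idP => [[i _]|mk].
  by rewrite addrC subr_eq0 eqr_nat => /eqP <-; exact: ltn_ord.
by exists (Ordinal mk) => //=; rewrite addNr.
Qed.

(** The degree is a real [mu], so the shifts [mu + 1] and [mu - 1] make sense even at [m = N] and
    [m = 0]. *)
Definition hahn_coef {R : realType} (beta mu : R) (l : nat) : R :=
  poch (- mu) l * poch (beta + mu) l.

Definition hahn_weight {R : realType} (nu alpha x : R) (l : nat) : R :=
  poch (- x) l / (l`!%:R * poch (- nu) l * poch (alpha - x) l).

Lemma hahn_coefS (R : realType) (beta mu : R) (l : nat) :
  hahn_coef beta mu l.+1
  = (l%:R - mu) * (beta + mu + l%:R) * hahn_coef beta mu l.
Proof. by rewrite /hahn_coef !pochSr; ring. Qed.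

(** The shift peels [- mu - 1] off the first symbol, while [beta + mu] extends the second one to
    [poch (beta + mu) l.+2]. This factor, which may vanish, comes from the numerator of [A_m]. *)
Lemma hahn_coef_raise (R : realType) (beta mu : R) (l : nat) :
  (beta + mu) * hahn_coef beta (mu + 1) l.+1
  = - (mu + 1) * (beta + mu + l%:R) * (beta + mu + l%:R + 1)
    * hahn_coef beta mu l.
Proof.
rewrite /hahn_coef pochSl opprD addrNK.
transitivity ((- mu - 1) * poch (- mu) l * poch (beta + mu) l.+2).
  by rewrite [poch (beta + mu) _]pochSl addrA mulrCA.
by rewrite !pochSr -natr1; ring.
Qed.

Lemma hahn_coef_lower (R : realType) (beta mu : R) (l : nat) :
  mu * hahn_coef beta (mu - 1) l.+1
  = - (l%:R - mu) * (l%:R + 1 - mu) * (beta + mu - 1) * hahn_coef beta mu l.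
Proof.
rewrite /hahn_coef [poch (_ + (_ - _)) _]pochSl addrA addrNK.
transitivity (- poch (- mu) l.+2 * (beta + mu - 1) * poch (beta + mu) l).
  by rewrite [poch (- mu) _]pochSl opprB [- mu + 1]addrC -mulNr opprK !mulrA.
by rewrite !pochSr -natr1; ring.
Qed.

Lemma hahn_weightS (R : realType) (nu alpha x : R) (l : nat) :
  hahn_weight nu alpha x l.+1
  = hahn_weight nu alpha x l * (l%:R - x)
    / ((l%:R + 1) * (l%:R - nu) * (alpha - x + l%:R)).
Proof.
rewrite /hahn_weight !pochSr factS natrM -natr1 -[- x + _]addrC.
by rewrite -[- nu + _]addrC !invfM; ring.
Qed.

(** Both terms on the left are multiples of [hahn_coef (b - nu) mu l], and the combined polynomial
    factor is divisible by [2 * mu + b - nu + 1]. *)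
Lemma hahn_raise_diff (R : realType) (nu b mu : R) (l : nat) :
  2 * mu + b - nu + 1 != 0 ->
  (mu + b - nu) / (2 * mu + b - nu + 1) *
    ((nu - mu) * hahn_coef (b - nu) (mu + 1) l.+1
     - (mu + b + 1) * hahn_coef (b - nu) mu l.+1)
  = (b - nu + mu + l%:R) * ((b - nu + mu) * (mu + 1) - b * (l%:R + 1))
    * hahn_coef (b - nu) mu l.
Proof.
move=> D1.
transitivity (((nu - mu) * ((b - nu + mu) * hahn_coef (b - nu) (mu + 1) l.+1)
     - (mu + b - nu) * (mu + b + 1) * hahn_coef (b - nu) mu l.+1)
     / (2 * mu + b - nu + 1)); first by ring.
by rewrite hahn_coef_raise hahn_coefS; field.
Qed.

(* For [mu = 0] both sides vanish, whatever the denominator. *)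
Lemma hahn_lower_diff (R : realType) (nu b mu : R) (l : nat) :
  mu = 0 \/ 2 * mu + b - nu - 1 != 0 ->
  mu / (2 * mu + b - nu - 1) *
    ((b + mu) * hahn_coef (b - nu) (mu - 1) l.+1
     + (mu - nu - 1) * hahn_coef (b - nu) mu l.+1)
  = (l%:R - mu) * (mu * (b - nu + mu - 1) - b * (l%:R + 1))
    * hahn_coef (b - nu) mu l.
Proof.
case=> [->|D2].
  rewrite !mul0r /hahn_coef oppr0 !addr0.
  by case: l => [|k]; rewrite ?pochSl !mul0r ?mulr0.
transitivity (((b + mu) * (mu * hahn_coef (b - nu) (mu - 1) l.+1)
     + mu * (mu - nu - 1) * hahn_coef (b - nu) mu l.+1)
     / (2 * mu + b - nu - 1)); first by ring.
by rewrite hahn_coef_lower hahn_coefS; field.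
Qed.

(** The summand is the recurrence with the prefactor of [V_m] taken out: the ratios of neighbouring
    prefactors produce [nu - mu] and [b + mu]. *)
Lemma hahn_partial_sum (R : realType) (nu alpha b x mu : R) (L : nat) :
  poch (- nu) L != 0 -> poch (alpha - x) L != 0 ->
  2 * mu + b - nu + 1 != 0 -> mu = 0 \/ 2 * mu + b - nu - 1 != 0 ->
  \sum_(l < L.+1) hahn_weight nu alpha x l *
    ((x - mu - alpha) *
       ((mu + b - nu) / (2 * mu + b - nu + 1) *
         ((nu - mu) * hahn_coef (b - nu) (mu + 1) l
          - (mu + b + 1) * hahn_coef (b - nu) mu l))
     - (x - nu + mu + b - alpha) *
       (mu / (2 * mu + b - nu - 1) *
         ((b + mu) * hahn_coef (b - nu) (mu - 1) l
          + (mu - nu - 1) * hahn_coef (b - nu) mu l))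
     - alpha * (2 * mu + b - nu) * hahn_coef (b - nu) mu l)
  = (2 * mu + b - nu) * (L%:R - x)
    * hahn_coef (b - nu) mu L * hahn_weight nu alpha x L.
Proof.
move=> + + D1 D2; elim: L => [|L IHL] nuL axL.
  rewrite big_ord1 /hahn_coef !poch0.
  case: D2 => [mu0|D2]; last by field; rewrite D1 D2.
  by rewrite mu0 mulr0 add0r in D1 *; rewrite !mul0r mulr0 add0r; field.
move: nuL axL; rewrite !pochSr !mulf_eq0 !negb_or.
move=> /andP[nuL nuL'] /andP[axL axL'].
(* Everything becomes a multiple of the coefficient and weight at [L], which leaves an identity of
   rational functions. *)
rewrite big_ord_recr /= {}IHL // hahn_raise_diff // hahn_lower_diff //.
rewrite hahn_coefS hahn_weightS -natr1.
by field; rewrite axL' addrC nuL' natr1 pnatr_eq0.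
Qed.

(** The added terms vanish because [poch (- m%:R) l = 0] for [m < l]. A range independent of [m]
    lets the three sums be combined termwise. *)
Lemma hahnU_sum (R : realType) (m N : nat) (x alpha b : R) :
  (m <= N)%N ->
  hahnU m x alpha b N
  = (-1) ^+ m * poch (- N%:R) m / poch (b + 1) m *
    \sum_(l < N.+1) hahn_weight N%:R alpha x l * hahn_coef (b - N%:R) m%:R l.
Proof.
move=> mN; rewrite /hahnU; congr (_ * _).
rewrite [RHS](bigID (fun l : 'I__ => (l < m.+1)%N)) /=.
rewrite [X in _ = _ + X]big1 ?addr0 => [|l]; last first.
  rewrite -leqNgt => ml; apply/eqP; rewrite /hahn_coef !mulf_eq0.
  by rewrite poch_oppn_eq0 ml orbT.
rewrite (big_ord_widen N.+1 (fun l => poch (- x) l * poch (- m%:R) l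
  * poch (b + m%:R - N%:R) l / (l`!%:R * poch (- N%:R) l * poch (alpha - x) l))) //.
apply: eq_bigr => l _; rewrite /hahn_weight /hahn_coef.
by rewrite [b - _ + _]addrAC; ring.
Qed.

Theorem proposition9 (R : realType) (N : nat) (a b : R)
    (hgen : generic a b N) (m n : nat) (hm : (m <= N)%N) (hn : (n <= N)%N) :
  (N%:R - n%:R - m%:R - b + a - 2) * hahnA m b N *
    (hahnV m.+1 n%:R a b N - hahnV m n%:R a b N)
  + (if m is m'.+1 then
       (- n%:R + m%:R + a - 2) * hahnC m b N *
         (hahnV m' n%:R a b N - hahnV m n%:R a b N)
     else 0)
  = (b - a + 2) * (2 * m%:R + b - N%:R) * hahnV m n%:R a b N.
Proof.
case: hgen => b0 ab0 D1 D2.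
pose x : R := N%:R - n%:R; pose alpha := b + 2 - a.
pose P k : R := (-1) ^+ k * poch (- N%:R) k / poch (b + 1) k.
pose F mu := \sum_(l < N.+1)
  hahn_weight N%:R alpha x l * hahn_coef (b - N%:R) mu l.
have VE k : (k <= N)%N -> hahnV k n%:R a b N = P k * F k%:R.
  by move=> kN; rewrite /hahnV kN hahnU_sum.
have PS k : (k < N)%N -> (k%:R + b + 1) * P k.+1 = (N%:R - k%:R) * P k.
  move=> kN; have := b0 _ kN; rewrite pochSr mulf_eq0 negb_or => /andP[bk bk'].
  by rewrite /P !pochSr exprS; field; rewrite bk bk'.
(* At [m = N] the left side is zero by the convention for [V_(N+1)], the right side by its factor
   [N - m]. *)
have raiseV : (m%:R + b + 1) * hahnV m.+1 n%:R a b N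
    = (N%:R - m%:R) * P m * F (m%:R + 1).
  have [mN|] := ltnP m N; first by rewrite VE // mulrA PS // natr1.
  by move=> Nm; rewrite /hahnV ltnNge Nm mulr0 (_ : m = N) ?subrr ?mul0r //;
    apply/eqP; rewrite eqn_leq hm.
have D2m : m%:R = 0 :> R \/ 2 * m%:R + b - N%:R - 1 != 0.
  by case: (m) hm => [|k] kN; [left | right; apply: D2].
have nuN : poch (- N%:R : R) N != 0 by rewrite poch_oppn_eq0 ltnn.
have sum0 := @hahn_partial_sum R N%:R alpha b x m%:R N nuN (ab0 _ _ hn (leqnn N))
  (D1 _ hm) D2m.
rewrite (_ : _ * hahn_weight _ _ _ N = 0) in sum0; last first.
  (* Here [x = N - n] is a natural number at most [N]. *)
  have xN : poch (- x) N.+1 = 0.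
    by apply/eqP; rewrite /x -natrB // poch_oppn_eq0 ltnS leq_subr.
  rewrite pochSr addrC in xN.
  transitivity ((2 * m%:R + b - N%:R) * hahn_coef (b - N%:R) m%:R N
    * (poch (- x) N * (N%:R - x))
    / (N`!%:R * poch (- N%:R) N * poch (alpha - x) N)).
    by rewrite /hahn_weight; ring.
  by rewrite xN mulr0 mul0r.
pose kA := (m%:R + b - N%:R) / (2 * m%:R + b - N%:R + 1).
pose kC := m%:R / (2 * m%:R + b - N%:R - 1).
pose down : R := (b + m%:R) * F (m%:R - 1) + (m%:R - N%:R - 1) * F m%:R.
transitivity ((x - m%:R - alpha) * (kA * (
      (m%:R + b + 1) * hahnV m.+1 n%:R a b N - (m%:R + b + 1) * (P m * F m%:R)))
    - (x - N%:R + m%:R + b - alpha) * kC * (P m * down)).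
  rewrite (VE m hm); congr (_ + _).
    by rewrite /hahnA /kA /x /alpha; ring.
  rewrite /kC /down /x /alpha.
  (* For [m = 0] the factor [m] in [kC] removes the term with [F (-1)], matching the omitted [C_0]
     term. Otherwise [PS] at [m - 1] relates [P m] to the prefactor of [V_(m-1)]. *)
  case: (m) hm => [|k] kN; first by ring.
  have -> : P k.+1 * ((b + k.+1%:R) * F (k.+1%:R - 1)
      + (k.+1%:R - N%:R - 1) * F k.+1%:R)
      = (N%:R - k%:R) * (P k * F k%:R - P k.+1 * F k.+1%:R).
    transitivity ((k%:R + b + 1) * P k.+1 * F (k.+1%:R - 1)
      - (N%:R - k%:R) * P k.+1 * F k.+1%:R); first by rewrite -natr1; ring.
    by rewrite PS // -natr1 addrK; ring.
  by rewrite (VE k (ltnW kN)) /hahnC -natr1; ring.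
rewrite raiseV (VE m hm); apply/eqP; rewrite -subr_eq0; apply/eqP.
(* Collecting by [F (m + 1)], [F (m - 1)] and [F m] allows a termwise comparison with [sum0]. *)
transitivity (P m * ((x - m%:R - alpha) * kA * (N%:R - m%:R) * F (m%:R + 1)
  - (x - N%:R + m%:R + b - alpha) * kC * (b + m%:R) * F (m%:R - 1)
  - ((x - m%:R - alpha) * kA * (m%:R + b + 1)
     + (x - N%:R + m%:R + b - alpha) * kC * (m%:R - N%:R - 1)
     + alpha * (2 * m%:R + b - N%:R)) * F m%:R)).
  by rewrite /down /alpha; ring.
rewrite -[RHS](mulr0 (P m)) -sum0; congr (_ * _).
rewrite /F !mulr_sumr -!sumrB; apply: eq_bigr => l _.
by rewrite /kA /kC; ring.
Qed.
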